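(* Let $K\ge 1$ be an integer, $\epsilon>0$ and $\Delta\in[0,1]$. For every feasible allocation sequence $(c_i)_{i\in\mathbb{Z}}$ under the $(K,\epsilon,\Delta)$ budget-unlocking strategy and every round $i\in\mathbb{Z}$, the available budget $b_i$ in round $i$ satisfies $$(1-\Delta)\frac{\epsilon}{K}\;\le\; b_i\;\le\;(1+\Delta)\frac{\epsilon}{K}.$$
   Context: Rounds are indexed by integers $i\in\mathbb{Z}$, and there is one group of users $G_j$ for each $j\in\mathbb{Z}$. Group $G_j$ becomes active in round $j$, stays active for exactly $K$ rounds and is then retired; thus the active groups in round $i$ are $G_{i-K+1},\dots,G_i$ (sliding window). Budget unlocking: each group has total scalar budget $\epsilon$. In the $k$-th round of its lifetime ($1\le k\le K$; for $G_j$ in round $i$ this is $k=i-j+1$), the cumulative unlocked budget of a group is $$\epsilon_k=\frac{\epsilon}{K}\left(k+\sum_{s=1}^{\min(k,\lfloor K/2\rfloor)}\Delta-\sum_{s=\lceil K/2\rceil+1}^{k}\Delta\right),$$ with empty sums equal to $0$. (So $(1+\Delta)\epsilon/K$ is unlocked in each round of the first half of the lifetime and $(1-\Delta)\epsilon/K$ in each round of the second half.) Allocation: in each round $i$ a total cost $c_i\ge 0$ is allocated, and this same cost is charged to every group active in round $i$. The available budget in round $i$ is the largest cost compatible with the unlocked budgets of all active groups: $$b_i=\min_{i-K+1\le j\le i}\left(\epsilon_{i-j+1}-\sum_{t=j}^{i-1}c_t\right).$$ The sequence $(c_i)_{i\in\mathbb{Z}}$ is feasible if $0\le c_i\le b_i$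 for all $i$, i.e. no active group ever consumes more than its currently unlocked budget. (A system starting in round $1$ with nothing consumed is the case $c_t=0$ for all $t\le 0$.) *)

(* Defs.v *)
From HB Require Import structures.
From mathcomp Require Import all_boot all_order all_algebra.

Set Implicit Arguments.
Unset Strict Implicit.
Unset Printing Implicit Defensive.

Import Order.TTheory GRing.Theory Num.Theory.
Local Open Scope ring_scope.

(* [K./2] is floor(K/2) and [uphalf K] is ceil(K/2); [k] counts rounds of the
   lifetime from 1. *)
Definition unlocked_budget (R : realFieldType) (K : nat) (eps Delta : R)
    (k : nat) : R :=
  eps / K%:R *
  (k%:R + \sum_(1 <= s < (minn k K./2).+1) Delta
        - \sum_((uphalf K).+1 <= s < k.+1) Delta).

(* Costs of the rounds j, ..., i - 1; meant for j <= i. *)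
Definition consumed (R : realFieldType) (c : int -> R) (j i : int) : R :=
  \sum_(s < absz (i - j)%R) c (j + s%:Z).

(* Unlocked and not yet consumed budget of the group G_j at the start of round
   i; meant for j <= i, where the age i - j + 1 is a positive integer. *)
Definition remaining (R : realFieldType) (K : nat) (eps Delta : R)
    (c : int -> R) (i j : int) : R :=
  unlocked_budget K eps Delta (absz (i - j + 1)%R) - consumed c j i.

(* The active groups are j = i - m with 0 <= m < K.  The initial value of the
   iterated minimum is the term m = 0, which belongs to the range when
   0 < K, so that this is the minimum over the active groups. *)
Definition available (R : realFieldType) (K : nat) (eps Delta : R)
    (c : int -> R) (i : int) : R :=
  \big[Num.min/remaining K eps Delta c i i]_(m < K)
    remaining K eps Delta c i (i - m%:Z).

Definition feasible (R : realFieldType) (K : nat) (eps Delta : R)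
    (c : int -> R) : Prop :=
  forall i : int, 0 <= c i <= available K eps Delta c i.

(* Main.v *)
(* A group active in round i and not newly activated was already active in
   round i - 1, where feasibility bounds its consumption including c_(i-1) by
   its unlocked budget.  So what remains for it in round i is at least the
   amount unlocked in round i, and every round unlocks at least
   (1 - Delta) eps / K.  The newest group, with nothing consumed, gives the
   upper bound. *)
Require Import Defs.
From HB Require Import structures.
From mathcomp Require Import all_boot all_order all_algebra.
From mathcomp Require Import zify lra.

Set Implicit Arguments.
Unset Strict Implicit.
Unset Printing Implicit Defensive.

Import Order.TTheory GRing.Theory Num.Theory.
Local Open Scope ring_scope.

Lemma unlocked_budgetE (R : realFieldType) (K : nat) (eps Delta : R) k :
  unlocked_budget K eps Delta k =
  eps / K%:R * (k%:R + Delta *+ minn k K./2 - Delta *+ (k - uphalf K)).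
Proof. by rewrite /unlocked_budget !sumr_const_nat subn1 subSS. Qed.

Lemma unlocked_budget0 (R : realFieldType) (K : nat) (eps Delta : R) :
  unlocked_budget K eps Delta 0 = 0.
Proof. by rewrite unlocked_budgetE min0n sub0n !mulr0n addr0 subr0 mulr0. Qed.

(** From one age to the next the bonus count [minn k K./2] cannot drop and the truncated difference
    [k - uphalf K] grows by at most one, so at most one [Delta] is lost. Age 0 is included. *)
Lemma unlocked_budgetS_ge (R : realFieldType) (K : nat) (eps Delta : R) k :
  0 <= eps -> 0 <= Delta ->
  unlocked_budget K eps Delta k + (1 - Delta) * (eps / K%:R)
    <= unlocked_budget K eps Delta k.+1.
Proof.
move=> eps_ge0 Delta_ge0; rewrite !unlocked_budgetE.
rewrite [(1 - Delta) * _]mulrC -mulrDr ler_wpM2l ?divr_ge0 ?ler0n //.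
have first_half : Delta *+ minn k K./2 <= Delta *+ minn k.+1 K./2.
  by apply: ler_wpMn2l => //; lia.
have second_half : Delta *+ (k.+1 - uphalf K) <= Delta *+ (k - uphalf K).+1.
  by apply: ler_wpMn2l => //; lia.
move: second_half; rewrite mulrSr -[k.+1%:R]natr1 => second_half; lra.
Qed.

Lemma unlocked_budget1_le (R : realFieldType) (K : nat) (eps Delta : R) :
  (0 < K)%N -> 0 <= eps -> 0 <= Delta ->
  unlocked_budget K eps Delta 1 <= (1 + Delta) * (eps / K%:R).
Proof.
move=> K_gt0 eps_ge0 Delta_ge0; rewrite unlocked_budgetE.
rewrite [leRHS]mulrC ler_wpM2l ?divr_ge0 ?ler0n //.
(* As [0 < K], no penalty applies at age 1. The bonus count is at most 1, and is 0 when [K = 1],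
   hence only an inequality. *)
have -> : (1 - uphalf K = 0)%N by lia.
by rewrite mulr0n subr0 lerD2l -[leRHS]mulr1n ler_wpMn2l // geq_minl.
Qed.

Lemma consumedD (R : realFieldType) (c : int -> R) (j : int) (n : nat) :
  consumed c j (j + n%:Z) = \sum_(s < n) c (j + s%:Z).
Proof. by rewrite /consumed addrAC subrr add0r absz_nat. Qed.

(** Describing the round by its natural offset from [j] removes the absolute values and allows a
    case split on the age. *)
Lemma remainingD (R : realFieldType) (K : nat) (eps Delta : R) (c : int -> R)
    (j : int) (n : nat) :
  remaining K eps Delta c (j + n%:Z) j =
  unlocked_budget K eps Delta n.+1 - \sum_(s < n) c (j + s%:Z).
Proof.
rewrite /remaining consumedD; congr (unlocked_budget _ _ _ _ - _); lia.
Qed.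

Lemma available_le_remaining (R : realFieldType) (K : nat) (eps Delta : R)
    (c : int -> R) (i : int) (m : nat) :
  (m < K)%N ->
  available K eps Delta c i <= remaining K eps Delta c i (i - m%:Z).
Proof.
by move=> ltmK; rewrite /available (bigD1 (Ordinal ltmK)) //= ge_min lexx.
Qed.

Lemma remaining_ge (R : realFieldType) (K : nat) (eps Delta : R)
    (c : int -> R) (j : int) (n : nat) :
  0 <= eps -> 0 <= Delta -> feasible K eps Delta c -> (n < K)%N ->
  (1 - Delta) * (eps / K%:R) <= remaining K eps Delta c (j + n%:Z) j.
Proof.
move=> eps_ge0 Delta_ge0 feas_c; rewrite remainingD.
case: n => [|n] ltnK.
  (* A new group has consumed nothing, and its first unlocking is the increment from age 0. *)
  have := unlocked_budgetS_ge K 0 eps_ge0 Delta_ge0.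
  by rewrite unlocked_budget0 add0r big_ord0 subr0.
(* One round earlier [G_j] had age [n.+1] and was active, so its costs up to and including
   [c (j + n)] fit in the budget unlocked at that age. *)
have /andP[_ c_le] := feas_c (j + n%:Z).
have := le_trans c_le (available_le_remaining eps Delta c _ (ltnW ltnK)).
rewrite addrK remainingD big_ord_recr /=.
have := unlocked_budgetS_ge K n.+1 eps_ge0 Delta_ge0; lra.
Qed.

Theorem theorem1 (R : realFieldType) (K : nat) (eps Delta : R)
  (hK : (1 <= K)%N) (heps : 0 < eps) (hDelta : 0 <= Delta <= 1)
  (c : int -> R) (hc : feasible K eps Delta c) (i : int) :
  (1 - Delta) * (eps / K%:R) <= available K eps Delta c i
  /\ available K eps Delta c i <= (1 + Delta) * (eps / K%:R).
Proof.
have eps_ge0 := ltW heps; have /andP[Delta_ge0 _] := hDelta.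
split.
  have ge_active m : (m < K)%N ->
      (1 - Delta) * (eps / K%:R) <= remaining K eps Delta c i (i - m%:Z).
    by move=> ltmK; rewrite -{1}(subrK m%:Z i) remaining_ge.
  apply: (big_ind (fun x => (1 - Delta) * (eps / K%:R) <= x)).
  (* The initial value of the minimum is the term [m = 0], in range because [0 < K]. *)
  - by rewrite -{2}[i]subr0 (ge_active 0%N).
  - by move=> x y lex ley; rewrite le_min lex.
  - by move=> m _; exact: ge_active.
apply: le_trans (available_le_remaining eps Delta c i hK) _.
rewrite subr0 -{1}[i]addr0 remainingD big_ord0 subr0.
exact: unlocked_budget1_le.
Qed.
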